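(* Let $n\ge 2$ and let $(x_{i_1},\ldots,x_{i_k})$ be a fixed finite sequence of Artin generators of the braid group $\mathcal{B}_n$. For $(a_1,\ldots,a_k)\in\mathbb{Z}^k$ let $\nabla_n(a_1,\ldots,a_k)\in\mathbb{C}[s,s^{-1}]$ denote the Alexander-Conway polynomial of the closure of the $n$-braid $x_{i_1}^{a_1}\cdots x_{i_k}^{a_k}$. Then for all $a_1,\ldots,a_k\in\mathbb{Z}$ and all $j\in\{1,\ldots,k\}$, $$\nabla_n(a_1,\ldots,a_j+2,\ldots,a_k)=(s^{-1}-s)\nabla_n(a_1,\ldots,a_j+1,\ldots,a_k)+\nabla_n(a_1,\ldots,a_j,\ldots,a_k).$$
   Context: The Alexander-Conway polynomial (in the variable $s$, where $t=s^{-2}$ for the usual variable $t$) is the oriented link invariant $\nabla$ with values in $\mathbb{C}[s,s^{-1}]$ determined by $\nabla(\bigcirc)=1$ (unknot) and the skein relation $\nabla(L_-)-(s^{-1}-s)\nabla(L_0)-\nabla(L_+)=0$ whenever $L_+,L_-,L_0$ are oriented diagrams identical except near one crossing, where $L_+$ has a positive crossing (both strands pointing up, the over-strand goes from lower left to upper right), $L_-$ a negative crossing and $L_0$ the oriented smoothing. Braid convention: $\mathcal{B}_n$ has Artin generators $x_1,\ldots,x_{n-1}$; in $x_i$ the strand going from top position $i$ to bottom position $i+1$ passes over the strand going from top position $i+1$ to bottom position $i$. Braids are oriented from top to bottom, so each crossing $x_i$ in the closure of a braid is a negative crossing (type $L_-$). *)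

(* Defs.v *)
From HB Require Import structures.
From mathcomp Require Import all_boot all_order all_algebra fraction.
From mathcomp Require Import boolp reals.
From mathcomp Require Import complex.

Set Implicit Arguments.
Unset Strict Implicit.
Unset Printing Implicit Defensive.

Import GRing.Theory.

Local Open Scope ring_scope.

(** [F[s, s^-1]], as the subring of [F(s)] of the fractions whose denominator
    is a power of [s]. *)
Definition is_laurent (F : fieldType) : {pred {fraction {poly F}}} :=
  fun f => `[< exists (p : {poly F}) (m : nat),
                 f = tofrac p / tofrac 'X ^+ m >].

Section Laurent.
Variable F : fieldType.

Lemma is_laurentP (f : {fraction {poly F}}) :
  reflect (exists (p : {poly F}) (m : nat), f = tofrac p / tofrac 'X ^+ m)
          (f \in @is_laurent F).
Proof. exact: asboolP. Qed.

Lemma tofracX_neq0 : tofrac ('X : {poly F}) != 0.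
Proof. by rewrite tofrac_eq0 polyX_eq0. Qed.

Lemma is_laurent_subring : subring_closed (@is_laurent F).
Proof.
have X0 m : tofrac ('X : {poly F}) ^+ m != 0 by rewrite expf_neq0 ?tofracX_neq0.
split=> [|f g /is_laurentP[p [m ->]] /is_laurentP[q [r ->]]
         |f g /is_laurentP[p [m ->]] /is_laurentP[q [r ->]]]; apply/is_laurentP.
- by exists 1, 0; rewrite expr0 divr1 tofrac1.
- exists (p * 'X^r - q * 'X^m), (m + r)%N.
  by rewrite -mulNr addf_div // rmorphB !rmorphM !rmorphXn exprD mulNr.
- by exists (p * q), (m + r)%N; rewrite mulf_div rmorphM exprD.
Qed.

HB.instance Definition _ :=
  GRing.isSubringClosed.Build {fraction {poly F}} (@is_laurent F)
    is_laurent_subring.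

Record laurent := Laurent {
  laurent_val : {fraction {poly F}};
  _ : laurent_val \in @is_laurent F
}.

HB.instance Definition _ := [isSub for laurent_val].
HB.instance Definition _ := [Choice of laurent by <:].
HB.instance Definition _ := [SubChoice_isSubComNzRing of laurent by <:].

Lemma is_laurent_s : tofrac 'X \in @is_laurent F.
Proof. by apply/is_laurentP; exists 'X, 0; rewrite expr0 divr1. Qed.

Lemma is_laurent_sV : (tofrac 'X)^-1 \in @is_laurent F.
Proof. by apply/is_laurentP; exists 1, 1; rewrite expr1 tofrac1 div1r. Qed.

Definition laurent_s : laurent := Laurent is_laurent_s.
Definition laurent_sV : laurent := Laurent is_laurent_sV.

Lemma laurent_sK : laurent_sV * laurent_s = 1.
Proof. by apply: val_inj; rewrite /= mulVf ?tofracX_neq0. Qed.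

End Laurent.

(** A generic oriented link diagram in the plane is cut by horizontal lines
    into layers, listed from top to bottom, each containing a single local
    maximum, local minimum or crossing; all other strands of the layer are
    vertical.  A horizontal line meets the diagram in a sequence of strands,
    read from left to right and recorded by their directions: [true] for a
    strand oriented downwards, [false] for one oriented upwards. *)

Inductive event :=
  (** [Max o]: the left leg of the cap has direction [o], the right leg
      [~~ o]. *)
  | Max of bool
  | Min
  (** [Cross b]: the strand joining top left to bottom right passes over the
      other one iff [b]. *)
  | Cross of bool.

(** [(i, e)]: the event [e], with exactly [i] vertical strands on its left. *)
Definition layer := (nat * event)%type.

Definition inputs (e : event) : nat := if e is Max _ then 0%N else 2%N.
Definition outputs (e : event) : nat := if e is Min then 0%N else 2%N.

(** The strands below a layer, given the strands above it; [None] if the layer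
    does not fit, because of the number of strands or of their directions. *)
Definition step (w : seq bool) (l : layer) : option (seq bool) :=
  let: (i, e) := l in
  match e, drop i w with
  | Max o, w' =>
      if (i <= size w)%N then Some (take i w ++ [:: o, ~~ o & w']) else None
  | Min, [:: a, c & w'] => if a != c then Some (take i w ++ w') else None
  | Cross _, [:: a, c & w'] => Some (take i w ++ [:: c, a & w'])
  | _, _ => None
  end.

Fixpoint run (w : seq bool) (d : seq layer) : option (seq bool) :=
  if d is l :: d' then obind (run^~ d') (step w l) else Some w.

Definition is_link_diagram (d : seq layer) : bool :=
  run [::] d == Some [::].

Definition link_diagram := {d : seq layer | is_link_diagram d}.

(** The moves of Freyd, Yetter and Turaev: with commutation of distant layers,
    zigzags and slides for planar isotopy, and the Reidemeister moves, they
    relate any two diagrams of isotopic links.  A move only applies when both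
    sides fit in the surrounding diagram, so it respects the orientations. *)
Inductive local_move : seq layer -> seq layer -> Prop :=
  | FarCommutation i j e f :
      local_move [:: (i, e); ((i + outputs e + j)%N, f)]
                 [:: ((i + inputs e + j)%N, f); (i, e)]
  | ZigzagLeft i o : local_move [:: (i, Max o); (i.+1, Min)] [::]
  | ZigzagRight i o : local_move [:: (i.+1, Max o); (i, Min)] [::]
  | MaxSlide i o b :
      local_move [:: (i, Max o); (i.+1, Cross b)]
                 [:: (i.+1, Max o); (i, Cross (~~ b))]
  | MinSlide i b :
      local_move [:: (i.+1, Cross b); (i, Min)]
                 [:: (i, Cross (~~ b)); (i.+1, Min)]
  | Reidemeister1Max i o b :
      local_move [:: (i, Max o); (i, Cross b)] [:: (i, Max (~~ o))]
  | Reidemeister1Min i b :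
      local_move [:: (i, Cross b); (i, Min)] [:: (i, Min)]
  | Reidemeister2 i b :
      local_move [:: (i, Cross b); (i, Cross (~~ b))] [::]
  (** The hypothesis excludes the two assignments in which the three strands
      lie cyclically over one another. *)
  | Reidemeister3 i b c d of (b == d ==> (c == b)) :
      local_move [:: (i, Cross b); (i.+1, Cross c); (i, Cross d)]
                 [:: (i.+1, Cross d); (i, Cross c); (i.+1, Cross b)].

Definition isotopy_move (D D' : link_diagram) : Prop :=
  exists pre post u v : seq layer,
    [/\ local_move u v, val D = pre ++ u ++ post & val D' = pre ++ v ++ post].

Definition link_invariant (T : Type) (f : link_diagram -> T) : Prop :=
  forall D D', isotopy_move D D' -> f D = f D'.

(** In the next two definitions [a] and [c] are the directions of the upper
    left and upper right ends of a crossing.  If [a = c], rotating the crossing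
    so that both strands point up, the strand joining top left to bottom right
    becomes the one going from lower right to upper left, so [Cross true] is
    negative.  If [a <> c], both strands point to the right or both to the
    left, the same strand becomes the one going from lower left to upper right,
    and [Cross true] is positive. *)
Definition positive_crossing (a c : bool) : event := Cross (a != c).
Definition negative_crossing (a c : bool) : event := Cross (a == c).

Definition oriented_smoothing (i : nat) (a c : bool) : seq layer :=
  if a == c then [::] else [:: (i, Min); (i, Max c)].

Definition skein_triple (Lp Lm L0 : link_diagram) : Prop :=
  exists (pre post : seq layer) (wl wr : seq bool) (a c : bool),
    let i := size wl in
    [/\ run [::] pre = Some (wl ++ [:: a, c & wr]),
        val Lp = pre ++ [:: (i, positive_crossing a c)] ++ post,
        val Lm = pre ++ [:: (i, negative_crossing a c)] ++ post &
        val L0 = pre ++ oriented_smoothing i a c ++ post].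

Definition unknot : link_diagram :=
  exist is_link_diagram [:: (0%N, Max true); (0%N, Min)] isT.

Definition is_alexander_conway (R : realType)
    (nabla : link_diagram -> laurent R[i]) : Prop :=
  [/\ link_invariant nabla,
      nabla unknot = 1 &
      forall Lp Lm L0, skein_triple Lp Lm L0 ->
        nabla Lm - (laurent_sV _ - laurent_s _) * nabla L0 - nabla Lp = 0].

(** The letter [(i, true)] stands for the Artin generator number [i + 1], and
    [(i, false)] for its inverse. *)
Definition braid_word (n : nat) := seq ('I_n.-1 * bool).

(** In [Cross true], as in an Artin generator, the strand going from top left
    to bottom right passes over the other one. *)
Definition braid_layers (n : nat) (w : braid_word n) : seq layer :=
  [seq (nat_of_ord l.1, Cross l.2) | l <- w].

(** The braid, oriented downwards, occupies the [n] leftmost positions, and the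
    [n] closing strands, oriented upwards, run on its right. *)
Definition closure_layers (n : nat) (w : braid_word n) : seq layer :=
  [seq (i, Max true) | i <- iota 0 n] ++ braid_layers w
    ++ [seq (i, Min) | i <- rev (iota 0 n)].

Lemma run_cat w d d' : run w (d ++ d') = obind (run^~ d') (run w d).
Proof. by elim: d w => //= l d IHd w; case: (step w l) => //= w'. Qed.

Lemma nseq_cat_cons (T : Type) n (x : T) t :
  nseq n x ++ x :: t = x :: nseq n x ++ t.
Proof. by elim: n => //= n ->. Qed.

Lemma run_maxima n :
  run [::] [seq (i, Max true) | i <- iota 0 n]
    = Some (nseq n true ++ nseq n false).
Proof.
elim: n => // n IHn.
rewrite -addn1 iotaD map_cat run_cat IHn /= size_cat !size_nseq leq_addr.
rewrite take_size_cat ?size_nseq // drop_size_cat ?size_nseq //.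
by rewrite nseq_cat_cons addn1.
Qed.

Lemma run_minima n :
  run (nseq n true ++ nseq n false) [seq (i, Min) | i <- rev (iota 0 n)]
    = Some [::].
Proof.
elim: n => // n IHn.
rewrite -{3}addn1 iotaD rev_cat /= add0n -nseq_cat_cons.
by rewrite drop_size_cat ?size_nseq // take_size_cat ?size_nseq.
Qed.

Lemma run_braid n (w : braid_word n) :
  run (nseq n true ++ nseq n false) (braid_layers w)
    = Some (nseq n true ++ nseq n false).
Proof.
elim: w => // -[i b] w IHw.
have i_lt : (i.+1 < n)%N by rewrite -ltn_predRL.
have e : nseq n true = nseq i true ++ [:: true, true & nseq (n - i.+2) true].
  by rewrite -[in LHS](subnKC i_lt) !nseq_cat_cons /= -nseqD.
suff fixed : step (nseq n true ++ nseq n false) (nat_of_ord i, Cross b)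
    = Some (nseq n true ++ nseq n false).
  by rewrite [LHS]/= -/(step _ (nat_of_ord i, Cross b)) fixed.
by rewrite /= e -catA drop_size_cat ?size_nseq //= take_size_cat ?size_nseq.
Qed.

Lemma closure_is_link_diagram n (w : braid_word n) :
  is_link_diagram (closure_layers w).
Proof.
by rewrite /is_link_diagram !run_cat run_maxima /= run_cat run_braid /=
  run_minima.
Qed.

Definition braid_closure (n : nat) (w : braid_word n) : link_diagram :=
  exist is_link_diagram (closure_layers w) (closure_is_link_diagram w).

Definition generator_power (n : nat) (i : 'I_n.-1) (a : int) : braid_word n :=
  nseq `|a|%N (i, 0 <= a).

Definition power_product (n k : nat) (i : 'I_k -> 'I_n.-1) (a : 'I_k -> int) :
    braid_word n :=
  flatten [seq generator_power (i m) (a m) | m <- enum 'I_k].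

(* Main.v *)
Require Import Defs.
From mathcomp Require Import all_boot all_order all_algebra reals complex.

Import GRing.Theory.

(** Apply the skein relation to a crossing [x_i] inserted next to
    [x_i^(a_j + 1)]: the three diagrams of the triple are closures of words
    that represent the exponents [a_j + 2], [a_j + 1] and [a_j], up to a
    Reidemeister move of type II that cancels [x_i x_i^-1] or [x_i^-1 x_i]. *)

Local Open Scope ring_scope.

Lemma braid_layers_cat n (u v : braid_word n) :
  braid_layers (u ++ v) = braid_layers u ++ braid_layers v.
Proof. exact: map_cat. Qed.

Lemma braid_closure_cancel T (f : link_diagram -> T) (f_inv : link_invariant f)
    n (u v : braid_word n) (i : 'I_n.-1) (b : bool) :
  f (braid_closure (u ++ (i, b) :: (i, ~~ b) :: v)) = f (braid_closure (u ++ v)).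
Proof.
apply: f_inv.
exists ([seq (i, Max true) | i <- iota 0 n] ++ braid_layers u),
  (braid_layers v ++ [seq (i, Min) | i <- rev (iota 0 n)]),
  [:: (nat_of_ord i, Cross b); (nat_of_ord i, Cross (~~ b))], [::].
split; first exact: Reidemeister2.
- by rewrite /= /closure_layers braid_layers_cat -!catA.
- by rewrite /= /closure_layers braid_layers_cat -!catA.
Qed.

(** All strands of the braid point downwards, so both upper ends of the crossing have direction
    [true]. For these directions [Cross true] is negative, [Cross false] is positive, and the
    oriented smoothing deletes the layer. *)
Lemma braid_closure_skein_triple n (u v : braid_word n) (i : 'I_n.-1) :
  skein_triple (braid_closure (u ++ (i, false) :: v))
    (braid_closure (u ++ (i, true) :: v)) (braid_closure (u ++ v)).
Proof.
have i_lt : (i.+1 < n)%N by rewrite -ltn_predRL.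
exists ([seq (i, Max true) | i <- iota 0 n] ++ braid_layers u),
  (braid_layers v ++ [seq (i, Min) | i <- rev (iota 0 n)]),
  (nseq i true), (nseq (n - i.+2)%N true ++ nseq n false), true, true.
rewrite size_nseq; split.
- rewrite run_cat run_maxima /= run_braid; congr Some.
  have -> : nseq n true = nseq i true ++ [:: true, true & nseq (n - i.+2) true].
    by rewrite -[in LHS](subnKC i_lt) -addn2 !nseqD -catA.
  by rewrite -catA.
- by rewrite /= /closure_layers braid_layers_cat -!catA.
- by rewrite /= /closure_layers braid_layers_cat -!catA.
- by rewrite /= /closure_layers braid_layers_cat -!catA.
Qed.

(** For [a >= 0] the two words coincide; for [a < 0] the power starts with [x_i^-1], which the extra
    [x_i] cancels. *)
Lemma braid_closure_power_succ T (f : link_diagram -> T)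
    (f_inv : link_invariant f) n (u v : braid_word n) (i : 'I_n.-1) (a : int) :
  f (braid_closure (u ++ (i, true) :: generator_power i a ++ v))
    = f (braid_closure (u ++ generator_power i (a + 1) ++ v)).
Proof.
case: a => [m|m]; first by rewrite -PoszD addn1.
rewrite NegzE (braid_closure_cancel T f f_inv n u (nseq m (i, false) ++ v) i true).
(* For [m = 0] the new exponent is 0, which has sign [true], but both words are empty. *)
by case: m => // m; rewrite -[m.+2]addn1 PoszD opprD addrNK.
Qed.

(** Here a cancellation occurs for [a >= 0]; for [a < 0] the words coincide, both being [x_i^-1] in
    the middle when [a = -1]. *)
Lemma braid_closure_power_pred T (f : link_diagram -> T)
    (f_inv : link_invariant f) n (u v : braid_word n) (i : 'I_n.-1) (a : int) :
  f (braid_closure (u ++ (i, false) :: generator_power i (a + 1) ++ v))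
    = f (braid_closure (u ++ generator_power i a ++ v)).
Proof.
case: a => [m|[|m]] //.
  rewrite -PoszD addn1.
  exact: (braid_closure_cancel T f f_inv n u (nseq m (i, true) ++ v) i false).
by rewrite !NegzE -[m.+2]addn1 PoszD opprD addrNK -opprD -PoszD addn1.
Qed.

(** The words [u] and [v] are chosen before [b], so one splitting serves all three exponent vectors
    of the recurrence. *)
Lemma power_product_split n k (i : 'I_k -> 'I_n.-1) (a : 'I_k -> int) j :
  exists u v : braid_word n, forall b : 'I_k -> int,
    (forall m, m != j -> b m = a m) ->
    power_product i b = u ++ generator_power (i j) (b j) ++ v.
Proof.
have := enum_uniq 'I_k; have := mem_enum 'I_k j; rewrite /power_product.
(* The enumeration has no repetition, so [j] lies in neither [s] nor [t]. *)
case/splitPr=> s t; rewrite uniq_catC /= mem_cat negb_or.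
case/andP=> /andP[jNt jNs] _.
exists (flatten [seq generator_power (i m) (a m) | m <- s]),
  (flatten [seq generator_power (i m) (a m) | m <- t]) => b ba.
rewrite map_cat flatten_cat /=; congr (flatten _ ++ _ ++ flatten _).
- by apply/eq_in_map=> m ms; rewrite ba //; apply: contraNneq jNs => <-.
- by apply/eq_in_map=> m mt; rewrite ba //; apply: contraNneq jNt => <-.
Qed.

Theorem corollary1p2 (R : realType) (nabla : link_diagram -> laurent R[i])
    (Hnabla : is_alexander_conway nabla)
    (n : nat) (hn : (2 <= n)%N) (k : nat) (i : 'I_k -> 'I_n.-1) :
  let nabla_n (a : 'I_k -> int) := nabla (braid_closure (power_product i a)) in
  forall (a : 'I_k -> int) (j : 'I_k),
    nabla_n [eta a with j |-> a j + 2] =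
      (laurent_sV _ - laurent_s _) * nabla_n [eta a with j |-> a j + 1]
      + nabla_n a.
Proof.
case: Hnabla => nabla_inv _ skein nabla_n a j; rewrite /nabla_n.
have [u [v split_j]] := power_product_split n k i a j.
rewrite !split_j //=; try by move=> m /negPf ->.
have /skein := braid_closure_skein_triple n u
  (generator_power (i j) (a j + 1) ++ v) (i j).
(* The negative diagram acquires exponent [a j + 2] and the positive one [a j]; the smoothing
   already has [a j + 1]. *)
rewrite braid_closure_power_succ // braid_closure_power_pred // -addrA !eqxx.
by rewrite -addrA -opprD => /eqP; rewrite subr_eq0 => /eqP.
Qed.
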